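(* For every integer $c\ge 1$, there exists $d\ge 1$ such that if $T$ is a tournament with $\operatorname{dom}(T)\ge d$, then there is a complete pair $(A,B)$ of $T$ such that $\chi(A)\ge c$ and $\chi(B)\ge c$.
   Context: All tournaments are finite. The chromatic number $\chi(T)$ of a tournament $T$ is the minimum $k$ such that $V(T)$ is the union of $k$ sets each inducing an acyclic (transitive) subtournament; for $X\subseteq V(T)$, $\chi(X)$ means $\chi(T[X])$, where $T[X]$ is the subtournament induced on $X$. The domination number $\operatorname{dom}(T)$ is the size of the smallest set $X\subseteq V(T)$ such that every vertex in $V(T)\setminus X$ is adjacent from a vertex in $X$ (i.e. is the head of an edge with tail in $X$). A pair $(A,B)$ of disjoint subsets of $V(T)$ is a complete pair if every edge between $A$ and $B$ is directed from $A$ to $B$. *)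

(* Defs.v *)
From mathcomp Require Import all_boot.

Set Implicit Arguments.
Unset Strict Implicit.
Unset Printing Implicit Defensive.

Record tournament := Tournament {
  vertex :> finType;
  arc : rel vertex;
  arc_irrefl : irreflexive arc;
  arc_tournament : forall x y, x != y -> arc x y (+) arc y x
}.

Arguments arc {t}.

Section Tournaments.
Variable T : tournament.
Implicit Types A B X D : {set T}.

Definition arc_in X : rel T := [rel x y | [&& x \in X, y \in X & arc x y]].

(* No arc u -> v of T[X] is closed up by a directed path of T[X] from v back
   to u; [acyclicP] states this as the absence of directed cycles. *)
Definition acyclic X : bool :=
  [forall u, forall v, arc_in X u v ==> ~~ connect (arc_in X) v u].

Lemma acyclicP X :
  reflect (forall s : seq T, {subset s <= X} -> cycle arc s -> s = [::])
          (acyclic X).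
Proof.
have cycE (s : seq T) : {subset s <= X} -> cycle (arc_in X) s = cycle arc s.
  move=> sX; apply: (@eq_in_cycle _ (mem X)); last by apply/allP.
  by move=> x y xX yX; rewrite /arc_in /= [x \in X]xX [y \in X]yX.
apply: (iffP forallP) => [acX [//|x s] sX | noC u].
  rewrite -cycE //=; case: s sX => [|y s] sX /=.
    by rewrite /= /arc_in /= arc_irrefl !andbF.
  case/andP=> xy pth; have /forallP/(_ y) := acX x.
  rewrite xy /= => /negP[]; apply/connectP.
  by exists (rcons s x) => //; rewrite last_rcons.
apply/forallP=> v; apply/implyP=> uv; apply/negP=> /connectP[p pth up].
have cyc : cycle (arc_in X) (v :: p) by rewrite /= rcons_path pth -up.
suff sX : {subset v :: p <= X} by have := noC _ sX; rewrite -cycE // => /(_ cyc).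
move=> x xp; have := next_cycle cyc xp.
by case/and3P.
Qed.

(* The union of [k] acyclic sets; sets may be empty or repeated. *)
Definition colorable X (k : nat) : bool :=
  [exists P : {ffun 'I_k -> {set T}},
    (X == \bigcup_(i < k) P i) && [forall i, acyclic (P i)]].

Lemma colorable_ex X : exists k, colorable X k.
Proof.
exists #|X|; apply/existsP; exists [ffun i => [set enum_val i]].
apply/andP; split.
  apply/eqP/setP=> x; apply/idP/bigcupP => [xX | [i _]].
    by exists (enum_rank_in xX x); rewrite // ffunE enum_rankK_in ?inE.
  by rewrite ffunE inE => /eqP ->; apply: enum_valP.
apply/forallP=> i; apply/forallP=> u; apply/forallP=> v; apply/implyP.
by rewrite ffunE /arc_in /= !inE => /and3P[/eqP-> /eqP->]; rewrite arc_irrefl.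
Qed.

(* chi(T[X]): the subsets of X that are acyclic in T[X] are those acyclic in T. *)
Definition chi X : nat := ex_minn (colorable_ex X).

Definition dominating D : bool :=
  [forall y in ~: D, exists x in D, arc x y].

Definition dom : nat := #|[arg min_(D < setT | dominating D) #|D| ]|.

(* Vertices of disjoint sets are always joined by exactly one arc. *)
Definition complete_pair A B : bool :=
  [disjoint A & B] && [forall x in A, forall y in B, arc x y].

(* [setT] is a legitimate base point for the minimum defining [dom]. *)
Lemma dominating_setT : dominating setT.
Proof. by apply/forall_inP=> y; rewrite setCT inE. Qed.

End Tournaments.

(* Main.v *)
Require Import Defs.
From mathcomp Require Import all_boot.

(** A tournament of large domination number contains a bounded-size set of
    large chromatic number (Harutyunyan, Le, Thomasse and Wu).  Take such a set
    A with chi(A) >= c, and let B be the set of vertices with an arc to every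
    vertex of A.  Since A dominates everything outside B, and chi >= dom,
    the chromatic number of B is at least dom(T) - |A|, which is large.

    The cited result goes by induction on k.  Let D be a minimum dominating
    set and W a large bounded part of D.  The common in-neighbours of W have
    large domination number, so they contain a bounded B with chi(B) >= k.  For
    each large S inside W, minimality of D makes N^+(S) hard to dominate, even
    after removal of what B dominates, so there is a bounded A_S with
    chi(A_S) >= k, dominated by S and complete to B.  In a k-colouring of the
    union of W, B and the A_S, some colour class has large trace S on W, and it
    meets B and A_S, which gives a monochromatic triangle b -> s -> a -> b. *)

Section Domination.

Set Implicit Arguments.
Unset Strict Implicit.
Unset Printing Implicit Defensive.

(* [path] also exports an [arc]. *)
Notation arc := Defs.arc.

(** * Cardinalities of finite sets *)

Lemma ex_subset_card (T : finType) (D : {set T}) n :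
  n <= #|D| -> exists2 W : {set T}, W \subset D & #|W| = n.
Proof.
move=> leD; exists [set x in take n (enum D)].
  by apply/subsetP=> x; rewrite inE => /mem_take; rewrite mem_enum.
have U: uniq (take n (enum D)) by rewrite take_uniq ?enum_uniq.
rewrite (eq_card (B := mem (take n (enum D)))); last by move=> x; rewrite inE.
by rewrite (card_uniqP U) size_takel // -cardE.
Qed.

Lemma leq_card_bigcup (I T : finType) (P : {set I}) (F : I -> {set T}) n :
  (forall i, i \in P -> #|F i| <= n) -> #|\bigcup_(i in P) F i| <= #|P| * n.
Proof.
move=> leF; rewrite -sum_nat_const.
elim/big_rec2: _ => [|i s U iP leU]; first by rewrite cards0.
apply: leq_trans (leq_card_setU _ _) _.
by rewrite leq_add ?leF.
Qed.

Section Tournament.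
Variable T : tournament.
Implicit Types (x y z : T) (A B D P S W X : {set T}).

Lemma arc_asym x y : arc x y -> arc y x = false.
Proof.
move=> xy; have : x != y by apply: contraTneq xy => ->; rewrite arc_irrefl.
by move/arc_tournament; rewrite xy /=; case: (arc y x).
Qed.

Lemma arc_or x y : x != y -> arc x y || arc y x.
Proof. by move/arc_tournament; case: (arc x y). Qed.

Lemma acyclicS A B : A \subset B -> acyclic B -> acyclic A.
Proof.
move=> sAB /acyclicP acB; apply/acyclicP=> s sA.
by apply: acB => x /sA; apply: (subsetP sAB).
Qed.

Lemma acyclic0 : acyclic (set0 : {set T}).
Proof.
apply/acyclicP=> -[//|x s] s0.
by have := s0 x (mem_head _ _); rewrite inE.
Qed.

Lemma acyclic_no_triangle P x y z : acyclic P -> x \in P -> y \in P ->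
  z \in P -> arc x y -> arc y z -> arc z x = false.
Proof.
move=> /acyclicP acP xP yP zP xy yz; apply/negP=> zx.
suff: [:: x; y; z] = [::] by [].
apply: acP; last by rewrite /= xy yz zx.
by move=> u; rewrite !inE => /or3P[] /eqP->.
Qed.

(** * Closed out-neighbourhoods and domination inside a set *)

Definition ball S := [set y | (y \in S) || [exists x in S, arc x y]].

Lemma ballP S y :
  reflect (y \in S \/ exists2 x, x \in S & arc x y) (y \in ball S).
Proof.
rewrite inE; apply: (iffP orP) => -[yS|];
  by [left | right; apply/exists_inP].
Qed.

Lemma notin_ball S x y : x \in S -> y \notin ball S -> arc y x.
Proof.
move=> xS yS; have neq_yx : y != x.
  by apply: contraNneq yS => ->; apply/ballP; left.
have /orP[//|xy] := arc_or neq_yx.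
by case/negP: yS; apply/ballP; right; exists x.
Qed.

Lemma sub_ball S : S \subset ball S.
Proof. by apply/subsetP=> x xS; apply/ballP; left. Qed.

Lemma ballS A B : A \subset B -> ball A \subset ball B.
Proof.
move=> /subsetP sAB; apply/subsetP=> y /ballP[/sAB|[x /sAB]] yB;
  by [apply/ballP; left | move=> xy; apply/ballP; right; exists x].
Qed.

Lemma ballU A B : ball (A :|: B) = ball A :|: ball B.
Proof.
apply/eqP; rewrite eqEsubset subUset !ballS ?subsetUl ?subsetUr // !andbT.
apply/subsetP=> y /ballP[|[x]]; rewrite !inE => /orP[] xS.
- by rewrite xS.
- by rewrite xS orbT.
- by move=> xy; apply/orP; left; apply/orP; right; apply/exists_inP; exists x.
- by move=> xy; apply/orP; right; apply/orP; right; apply/exists_inP; exists x.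
Qed.

(** A lower bound on the domination number of the subtournament induced on [X], so dominators must
    lie in [X]. *)
Definition dom_ge X n :=
  forall D, D \subset X -> X \subset ball D -> n <= #|D|.

Lemma dom_ge_setT n : n <= dom T -> dom_ge setT n.
Proof.
rewrite /dom; case: arg_minnP => [|D0 _ minD0]; first exact: dominating_setT.
move=> /leq_trans le_n D _ /subsetP DT; apply/le_n/minD0.
apply/forall_inP=> y; rewrite inE => yD; apply/exists_inP.
by have /ballP[yD'|//] := DT y (in_setT _); rewrite yD' in yD.
Qed.

(** Adding [S] to a set that dominates the remainder gives a dominating set of [X]. *)
Lemma dom_ge_setD_ball X S n : S \subset X -> dom_ge X (#|S| + n) ->
  dom_ge (X :\: ball S) n.
Proof.
move=> SX domX D DX XD; rewrite -(leq_add2l #|S|).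
apply: leq_trans (leq_card_setU S D); apply: domX.
  by rewrite subUset SX (subset_trans DX) ?subsetDl.
by rewrite ballU -subDset.
Qed.

Lemma dom_geW X m n : m <= n -> dom_ge X n -> dom_ge X m.
Proof. by move=> mn domX D DX XD; apply: leq_trans mn _; apply: domX. Qed.

Lemma min_dominating X : exists D,
  [/\ D \subset X, X \subset ball D & dom_ge X #|D|].
Proof.
pose dominates D := (D \subset X) && (X \subset ball D).
have domX : dominates X by rewrite /dominates subxx sub_ball.
case: (arg_minnP (fun D => #|D|) domX) => D /andP[DX XD] minD.
by exists D; split=> // E EX XE; apply: minD; rewrite /dominates EX.
Qed.

(** Take [s] of maximal out-degree in [P]. If [y -> s] with [y] in [P], every out-neighbour [z] of
    [s] in [P] satisfies [y -> z], else [s -> z -> y -> s] is a triangle; so [y] would beat more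
    vertices than [s]. *)
Lemma acyclic_source P : acyclic P -> P != set0 ->
  exists2 s, s \in P & P \subset ball [set s].
Proof.
move=> acP /set0Pn[s0 s0P].
case: (arg_maxnP (fun s => #|P :&: ball [set s]|) s0P) => s sP maxs.
exists s => //; apply/subsetP=> y yP; apply: contraT => ys.
have arc_ys : arc y s by apply: notin_ball ys; rewrite inE.
have /maxs : y \in P by [].
rewrite /= leqNgt => /negP[]; apply: proper_card; apply/properP; split; last first.
  by exists y; rewrite !in_setI yP ?(negPf ys) // (subsetP (sub_ball _)) ?inE.
apply/subsetP=> z; rewrite !in_setI => /andP[zP /ballP zs]; rewrite zP /=.
case: zs => [|[_ /set1P-> arc_sz]].
  by move/set1P=> ->; apply/ballP; right; exists y; rewrite ?inE.
apply: contraT => zy; have arc_zy : arc z y by apply: notin_ball zy; rewrite inE.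
by have := acyclic_no_triangle acP sP zP yP arc_sz arc_zy; rewrite arc_ys.
Qed.

(** * Colourings and the chromatic number *)

(** A partition in place of the possibly overlapping cover in [colorable]; the values of [f] off [X]
    are irrelevant. *)
Definition coloring X k (f : T -> nat) :=
  {in X, forall x, f x < k} /\ forall i, acyclic [set x in X | f x == i].

Lemma coloringS A X k f : A \subset X -> coloring X k f -> coloring A k f.
Proof.
move=> AX [fk acf]; split=> [x /(subsetP AX)/fk //|i].
apply: acyclicS (acf i); apply/subsetP=> x; rewrite !inE => /andP[xA ->].
by rewrite (subsetP AX).
Qed.

Lemma chi_leP X k : (chi X <= k) <-> exists f, coloring X k f.
Proof.
rewrite /chi; case: ex_minnP => m colm minm; split=> [le_mk|[f [fk acf]]].
  have /existsP[P /andP[/eqP XP /forallP acP]] := colm.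
  (* One class containing [x] is selected; the default [0] is reached only outside [X]. *)
  pose f x := if [pick i | x \in P i] is Some i then val i else 0.
  have fP x : x \in X -> exists2 i, x \in P i & f x = val i.
    rewrite XP => /bigcupP[i _ xi]; rewrite /f.
    by case: pickP => [j xj|/(_ i)]; [exists j | rewrite xi].
  exists f; split=> [x /fP[i _ ->]|i]; first exact: leq_trans (ltn_ord i) _.
  have [lt_im|le_mi] := ltnP i m.
    apply: acyclicS (acP (Ordinal lt_im)); apply/subsetP=> x; rewrite inE.
    by case/andP=> /fP[j xj ->] /eqP ji; rewrite (_ : Ordinal _ = j) //; apply/val_inj.
  apply: acyclicS acyclic0; apply/subsetP=> x; rewrite inE.
  by case/andP=> /fP[j _ ->] /eqP ji; move: (ltn_ord j); rewrite ltnNge ji le_mi.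
apply: minm; apply/existsP; exists [ffun i : 'I_k => [set x in X | f x == i]].
apply/andP; split; last by apply/forallP=> i; rewrite ffunE.
apply/eqP/setP=> x; apply/idP/bigcupP => [xX|[i _]].
  by exists (Ordinal (fk x xX)); rewrite // ffunE inE xX /=.
by rewrite ffunE inE => /andP[].
Qed.

Lemma chi0 : chi (set0 : {set T}) = 0.
Proof.
apply/eqP; rewrite -leqn0; apply/chi_leP; exists (fun=> 0).
split=> [x|i]; first by rewrite inE.
by apply: acyclicS acyclic0; apply/subsetP=> x; rewrite !inE.
Qed.

(** The sources of the nonempty classes of an optimal colouring together dominate [X]. *)
Lemma dom_ge_chi X n : dom_ge X n -> n <= chi X.
Proof.
move=> domX; have [f [fk acf]] := (chi_leP X (chi X)).1 (leqnn _).
pose C i := [set x in X | f x == i].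
have /fin_all_exists[D DP] (i : 'I_(chi X)) :
    exists D, [/\ D \subset X, C i \subset ball D & #|D| <= 1].
  have [C0|C0] := eqVneq (C i) set0.
    by exists set0; rewrite C0 !sub0set cards0.
  have [s] := acyclic_source (acf i) C0.
  rewrite inE => /andP[sX _] Cs; exists [set s].
  by rewrite sub1set cards1 sX.
rewrite -[chi X]muln1 -{1}[chi X]card_ord -cardsT.
apply: leq_trans (leq_card_bigcup (F := D) _); last by move=> i _; case: (DP i).
apply: domX; first by apply/bigcupsP=> i _; case: (DP i).
apply/subsetP=> x xX; pose i := Ordinal (fk x xX).
have [_ /subsetP Ci _] := DP i.
apply: (subsetP (ballS (bigcup_sup i _))) => //.
by apply: Ci; rewrite inE xX /=.
Qed.

(** If colour [i] were missing, the class of colour [k] could take it over, leaving only [k] colours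
    on [A]. *)
Lemma coloring_onto A k f i : k < chi A -> coloring A k.+1 f -> i < k.+1 ->
  exists2 x, x \in A & f x = i.
Proof.
move=> lt_kA [fk acf] lt_ik.
have [/exists_inP[x xA /eqP]|/exists_inPn noi] := boolP [exists x in A, f x == i].
  by exists x.
move: lt_kA; rewrite ltnNge => /negP[]; apply/chi_leP.
exists (fun x => if f x == k then i else f x); split=> [x xA|j].
  have := fk x xA; have := noi x xA; rewrite ltnS.
  case: (f x =P k) => [-> ki _|/eqP nk _ le_xk]; last by rewrite ltn_neqAle nk.
  by rewrite ltn_neqAle eq_sym ki -ltnS.
apply: acyclicS (acf (if j == i then k else j)); apply/subsetP=> x.
rewrite !inE => /andP[xA]; rewrite xA /=; have := noi x xA.
case: (f x =P k) => [-> _ /eqP->|_ ni /eqP <-]; first by rewrite eqxx.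
by rewrite (negPf ni).
Qed.

Lemma pigeonhole_coloring W k m f : coloring W k.+1 f -> k.+1 * m <= #|W| ->
  exists2 i, i < k.+1 & m <= #|[set x in W | f x == i]|.
Proof.
move=> [fk _] leW; pose C (i : 'I_k.+1) := [set x in W | f x == i].
have [/existsP[i mi]|/existsPn noi] := boolP [exists i, m <= #|C i|].
  by exists i.
have m_gt0 : 0 < m by have := noi ord0; case: (m).
have : #|W| <= k.+1 * m.-1.
  rewrite -[k.+1]card_ord -cardsT.
  apply: leq_trans (leq_card_bigcup (F := C) _) => [|i _]; last first.
    by have := noi i; rewrite -ltnNge -{1}(prednK m_gt0).
  apply: subset_leq_card; apply/subsetP=> x xW; apply/bigcupP.
  by exists (Ordinal (fk x xW)); rewrite // inE xW /=.
move/(leq_trans leW); rewrite leq_pmul2l // leqNgt => /negP[].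
by rewrite prednK.
Qed.

Lemma chi_gadget W B (F : {set T} -> {set T}) k m :
    k.+1 * m <= #|W| -> k < chi B -> B \subset ~: ball W ->
    (forall S, S \subset W -> m <= #|S| ->
       k < chi (F S) /\ F S \subset ball S :\: ball B) ->
  k.+1 < chi (W :|: B :|: \bigcup_(S in powerset W) F S).
Proof.
set U := _ :|: \bigcup_(S in _) _ => leW chiB /subsetP BW FP.
rewrite ltnNge; apply/negP => /chi_leP[f fU].
have WU : W \subset U by rewrite /U -setUA subsetUl.
have BU : B \subset U by rewrite /U setUAC subsetUr.
have [i lt_ik] := pigeonhole_coloring (coloringS WU fU) leW.
set S := [set _ in W | _] => leS.
have SW : S \subset W by apply/subsetP=> x; rewrite inE => /andP[].
have [chiF /subsetP FS] := FP S SW leS.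
have FU : F S \subset U.
  by apply: subset_trans (subsetUr _ _); apply: bigcup_sup; rewrite inE.
(* Neither [B] nor [F S] is colourable with [k] colours, so the popular colour [i] occurs in
   both. *)
have [b bB fb] := coloring_onto chiB (coloringS BU fU) lt_ik.
have [a aF fa] := coloring_onto chiF (coloringS FU fU) lt_ik.
have /BW := bB; rewrite inE => bW.
have := FS a aF; rewrite in_setD => /andP[aB /ballP aS].
have arc_ab := notin_ball bB aB.
have arc_bW s : s \in S -> arc b s by move/(subsetP SW)/notin_ball; apply.
(* [a] is not in [S] itself, since [b] beats all of [S] while [a] beats [b]; hence some [s] in [S]
   beats [a]. *)
case: aS => [/arc_bW|[s sS arc_sa]]; first by rewrite (arc_asym arc_ab).
have [_ /(_ i) acU] := fU; have sW := subsetP SW s sS.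
have fs : f s = i by move: sS; rewrite inE => /andP[_ /eqP].
have inC x (Y : {set T}) : Y \subset U -> x \in Y -> f x = i ->
    x \in [set x in U | f x == i].
  by move=> YU xY fx; rewrite in_set fx eqxx (subsetP YU x xY).
have := acyclic_no_triangle acU (inC _ _ BU bB fb) (inC _ _ WU sW fs)
  (inC _ _ FU aF fa) (arc_bW s sS) arc_sa.
by rewrite arc_ab.
Qed.

(* Otherwise [B] and few further vertices could replace [S] in [D]. *)
Lemma dom_ge_ball_min X D S B n :
    D \subset X -> X \subset ball D -> dom_ge X #|D| -> S \subset D ->
    B \subset X -> S \subset ball B -> #|B| + n <= #|S| ->
  dom_ge ((X :&: ball S) :\: ball B) n.
Proof.
move=> DX XD minD SD BX SB leS E EX XE.
rewrite -(leq_add2l #|B|); apply: leq_trans leS _.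
(* The goal becomes a bound on [#|D|], to be obtained by testing minimality on
   [D :\: S :|: (B :|: E)]. *)
rewrite -(leq_add2l #|D :\: S|) -{2}(setIidPr SD) addnC cardsID.
have EX' : E \subset X.
  by rewrite (subset_trans EX) // (subset_trans (subsetDl _ _)) ?subsetIl.
apply: leq_trans (minD (D :\: S :|: (B :|: E)) _ _) _.
- by rewrite !subUset BX EX' (subset_trans (subsetDl _ _)).
- rewrite !ballU setUCA -subDset.
  apply/subsetP=> x; rewrite in_setD => /andP[xB xX].
  have /ballP xD := subsetP XD x xX.
  have [xS|xS] := boolP (x \in ball S).
    by rewrite in_setU (subsetP XE) ?orbT // in_setD xB in_setI xX.
  (* Outside [ball S], the dominator provided by [D] cannot lie in [S], so it survives in
     [D :\: S]. *)
  rewrite in_setU; apply/orP; left; apply/ballP.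
  case: xD => [xD|[y yD xy]].
    by left; rewrite in_setD xD (contra _ xS) //; apply: (subsetP (sub_ball S)).
  right; exists y; rewrite // in_setD yD andbT.
  by apply: contra xS => yS; apply/ballP; right; exists y.
apply: leq_trans (leq_card_setU _ _) _.
by rewrite leq_add2l; apply: leq_trans (leq_card_setU _ _) _.
Qed.

End Tournament.

(** The bounds are uniform in [X] because the induction hypothesis is applied to [X :\: ball W] and
    to the sets [(X :&: ball S) :\: ball B]. *)
Lemma bounded_set_large_chi k : exists K n, forall (T : tournament)
  (X : {set T}), dom_ge X n ->
  exists A : {set T}, [/\ A \subset X, #|A| <= K & k < chi A].
Proof.
elim: k => [|k [K [n IHk]]].
  exists 1, 1 => T X domX; have /set0Pn[x xX] : X != set0.
    apply/eqP=> X0; have := domX set0; rewrite X0 !sub0set cards0.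
    by move=> /(_ isT isT).
  exists [set x]; rewrite sub1set cards1; split=> //.
  apply: dom_ge_chi => D _ xD; rewrite card_gt0; apply: contraTneq xD => ->.
  rewrite sub1set; apply/ballP; rewrite inE => -[//|[y]].
  by rewrite inE.
(* A trace [S] of size [m] pays for [B] (at most [K]) and still leaves domination [n]; [w] vertices
   in [k.+1] colours force a trace of that size. *)
pose m := K + n; pose w := k.+1 * m.
(* The size bound adds up [W], [B] and one set for each of the [2 ^ w] subsets of [W]; removing
   [ball W] lowers the threshold [w + n] to [n]. *)
exists (w + K + 2 ^ w * K), (w + n) => T X domX.
have [D [DX XD minD]] := min_dominating X.
have [W WD cardW] : exists2 W : {set T}, W \subset D & #|W| = w.
  by apply: ex_subset_card; apply: leq_trans (leq_addr n _) (domX D DX XD).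
have WX := subset_trans WD DX.
have [B [BXW cardB chiB]] : exists B : {set T},
    [/\ B \subset X :\: ball W, #|B| <= K & k < chi B].
  by apply: IHk; apply: dom_ge_setD_ball; rewrite ?cardW.
have [BX BW] : B \subset X /\ B \subset ~: ball W.
  by move: BXW; rewrite setDE subsetI => /andP[].
have WB : W \subset ball B.
  have /set0Pn[b bB] : B != set0.
    by apply: contraTneq chiB => ->; rewrite chi0.
  apply/subsetP=> s sW; apply/ballP; right; exists b => //.
  by apply: notin_ball sW _; have := subsetP BW b bB; rewrite inE.
have /fin_all_exists[F FP] (S : {set T}) : exists A : {set T},
    [/\ A \subset X, #|A| <= K & S \subset W -> m <= #|S| ->
       k < chi A /\ A \subset ball S :\: ball B].
  have [/andP[SW leS]|nS] := boolP ((S \subset W) && (m <= #|S|)); last first.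
    (* [F] is total on sets, so irrelevant [S] get the empty set, which keeps the union small. *)
    exists set0; rewrite sub0set cards0; split=> // SW leS.
    by rewrite SW leS in nS.
  have domS : dom_ge ((X :&: ball S) :\: ball B) n.
    apply: (dom_ge_ball_min DX XD minD (subset_trans SW WD) BX).
      exact: subset_trans SW WB.
    by apply: leq_trans leS; rewrite leq_add2r.
  have [A [AX cardA chiA]] := IHk T _ domS; exists A.
  have AXS : A \subset X :&: ball S by apply: subset_trans AX (subsetDl _ _).
  have := AXS; rewrite subsetI => /andP[-> _]; split=> // _ _; split=> //.
  by apply: subset_trans AX _; rewrite setSD ?subsetIr.
exists (W :|: B :|: \bigcup_(S in powerset W) F S); split.
- by rewrite !subUset WX BX; apply/bigcupsP=> S _; case: (FP S).
- apply: leq_trans (leq_card_setU _ _) _; apply: leq_add.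
    by apply: leq_trans (leq_card_setU _ _) _; rewrite cardW leq_add2l.
  by rewrite -cardW -card_powerset leq_card_bigcup // => S _; case: (FP S).
- apply: (chi_gadget (m := m)) => //; first by rewrite cardW.
  by move=> S; case: (FP S).
Qed.

End Domination.

Theorem mainTheorem2 (c : nat) (hc : 1 <= c) :
  exists d : nat, 1 <= d /\
    forall T : tournament, d <= dom T ->
      exists A B : {set T},
        complete_pair A B /\ c <= chi A /\ c <= chi B.
Proof.
have [K [n chi_dom]] := bounded_set_large_chi c.
(* The summand [n] yields [A]; [K + c] leaves domination [c] after the removal of [ball A], as
   [#|A| <= K]. *)
exists (K + c + n); split=> [|T /dom_ge_setT domT].
  by rewrite (leq_trans hc) // -addnA addnCA leq_addr.
have [A [_ cardA chiA]] := chi_dom T setT (dom_geW (leq_addl _ _) domT).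
(* The vertices outside [ball A] are those that beat all of [A], so they form the first member of
   the pair. *)
exists (~: ball A), A; split; last split; last exact: ltnW.
- rewrite /complete_pair -setI_eq0 setIC -setDE setD_eq0 sub_ball.
  apply/forall_inP=> x; rewrite inE => xA.
  by apply/forall_inP=> y yA; apply: notin_ball xA.
- apply: dom_ge_chi; rewrite -setTD; apply: dom_ge_setD_ball => //.
  apply: dom_geW domT.
  by rewrite -addnA leq_add ?leq_addr.
Qed.
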